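(* Let $(S,\cdot)$ be a commutative semigroup with identity. Then $(\beta S,\leq_{\mathcal{F}_{(S,\cdot)}})$ is upward directed, i.e. for all $\mathcal{U},\mathcal{V}\in\beta S$ there is $\mathcal{W}\in\beta S$ with $\mathcal{U}\leq_{\mathcal{F}_{(S,\cdot)}}\mathcal{W}$ and $\mathcal{V}\leq_{\mathcal{F}_{(S,\cdot)}}\mathcal{W}$. In particular $M(\beta S,\mathcal{F}_{(S,\cdot)})\neq\emptyset$.
   Context: $\mathcal{F}_{(S,\cdot)}$ is the family of all functions $f_r:S\to S$, $f_r(s)=s\cdot r$, for $r\in S$. For $A,B\subseteq S$ and a family $\mathcal{F}$ of functions $S\to S$, $A\leq_{\mathcal{F}}B$ means that for every finite $F\subseteq A$ there is $f\in\mathcal{F}$ with $f(F)\subseteq B$. For $\mathcal{U},\mathcal{V}\in\beta S$, $\mathcal{U}\leq_{\mathcal{F}}\mathcal{V}$ means that for every $B\in\mathcal{V}$ there is $A\in\mathcal{U}$ with $A\leq_{\mathcal{F}}B$. $M(\beta S,\mathcal{F})$ is the set of $\mathcal{U}\in\beta S$ such that $\mathcal{V}\leq_{\mathcal{F}}\mathcal{U}$ for every $\mathcal{V}\in\beta S$. *)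

(* Defs.v *)
From mathcomp Require Import all_boot boolp classical_sets cardinality filter.

Set Implicit Arguments.
Unset Strict Implicit.
Unset Printing Implicit Defensive.

Local Open Scope classical_set_scope.

(* The points of the Stone-Cech compactification of the discrete space [S],
   i.e. all ultrafilters on [S], principal ones included. *)
Definition beta (S : Type) : set (set_system S) := [set U | UltraFilter U].

Definition trans_family (S : monoidType) : set (S -> S) :=
  [set f | exists r : S, f = (fun s => (s * r)%g)].

Arguments trans_family : clear implicits.

Definition set_le (S : Type) (F : set (S -> S)) (A B : set S) : Prop :=
  forall H : set S, finite_set H -> H `<=` A ->
    exists2 f, F f & f @` H `<=` B.

Definition ultra_le (S : Type) (F : set (S -> S)) (U V : set_system S) : Prop :=
  forall B, V B -> exists2 A, U A & set_le F A B.

Definition maxset_beta (S : Type) (F : set (S -> S)) : set (set_system S) :=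
  [set U | beta U /\ forall V, beta V -> ultra_le F V U].

(* Main.v *)
(* For ultrafilters U and V put B \in U V iff s^-1 B \in V for U-many s.  If
   B \in U V, then every finite set of such s is moved into B by a common r,
   so U <= U V; and r |-> s r maps s^-1 B \in V into B for any one such s, so
   V <= U V by commutativity.  Hence the preorder is directed, and the sets
   belonging to all sufficiently large ultrafilters form a proper filter.  An
   ultrafilter extending it is maximal: if no member of V is below B, then no
   ultrafilter above V contains B, so the complement of B lies in this filter. *)
Require Import Defs.
From mathcomp Require Import all_boot boolp classical_sets cardinality filter.
From mathcomp Require Import finmap.

Local Open Scope classical_set_scope.

Section Preorder.
Variables (T : Type) (F : set (T -> T)).
Hypotheses (F_id : F id) (F_comp : forall f g, F f -> F g -> F (g \o f)).

Lemma ultra_le_refl (U : set_system T) : ultra_le F U U.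
Proof.
by move=> B UB; exists B => // H _ HB; exists id => //; rewrite image_id.
Qed.

Lemma set_le_trans (A B C : set T) : set_le F A B -> set_le F B C -> set_le F A C.
Proof.
move=> AB BC H finH HA; have [f Ff fHB] := AB H finH HA.
have [g Fg gfHC] := BC (f @` H) (finite_image f finH) fHB.
by exists (g \o f); [exact: F_comp | rewrite -image_comp].
Qed.

Lemma ultra_le_trans (U V W : set_system T) :
  ultra_le F U V -> ultra_le F V W -> ultra_le F U W.
Proof.
move=> UV VW B /VW[C /UV[A UA AC] CB].
by exists A => //; exact: set_le_trans AC CB.
Qed.

Lemma directed_maxset_beta_nonempty (t : T) :
  (forall U V, beta U -> beta V ->
     exists W, [/\ beta W, ultra_le F U W & ultra_le F V W]) ->
  maxset_beta F !=set0.
Proof.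
move=> dir.
pose E : set_system T := [set C | exists2 V : set_system T, beta V &
  forall W, beta W -> ultra_le F V W -> W C].
have EP : ProperFilter E.
  (* Properness uses reflexivity: [V] lies above itself, so an empty set in [E] would belong to
     [V]. *)
  split=> [[V bV /(_ V bV (ultra_le_refl V))]|].
    by case: bV => bV _; exact: filter_not_empty.
  split.
  - exists (principal_filter t); first exact: principal_filter_ultra.
    by move=> W [bW _] _; exact: filterT.
  (* By transitivity, every ultrafilter above a common bound [W] of the two witnesses contains both
     sets. *)
  - move=> A B [U bU UA] [V bV VB]; have [W [bW UW VW]] := dir U V bU bV.
    exists W => // X bX WX; have [[_ fX] _] := bX.
    apply: filterI; [apply: UA|apply: VB] => //; exact: ultra_le_trans WX.
  - move=> A B AB [V bV VA]; exists V => // W bW VW; have [[_ fW] _] := bW.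
    exact: filterS AB (VA W bW VW).
have [U [bU EU]] := ultraFilterLemma EP.
exists U; split=> // V bV B UB; apply: contrapT => nVB.
have UnB : U (~` B).
  apply: EU; exists V => // W bW VW.
  by have [/VW//|//] := in_ultra_setVsetC B bW.
have [[U0 fU] _] := bU.
by apply: U0; rewrite -(setICr B); exact: filterI.
Qed.

End Preorder.

Section UltraProduct.
Variable S : monoidType.

Definition ultra_mul (U V : set_system S) : set_system S :=
  [set B | U [set s | V [set r | B (s * r)%g]]].

Lemma ultra_mul_beta (U V : set_system S) :
  beta U -> beta V -> beta (ultra_mul U V).
Proof.
move=> bU bV; have [[U0 fU] _] := bU; have [[V0 fV] _] := bV.
(* [U] decides whether [V] contains the section of [B] at [U]-many [s]; if not, [V] contains the
   complementary section at [U]-many [s]. *)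
have mem_setVsetC B : ultra_mul U V B \/ ultra_mul U V (~` B).
  rewrite /ultra_mul/=.
  have [UB|UnB] := in_ultra_setVsetC [set s | V [set r | B (s * r)%g]] bU.
    by left.
  right; apply: filterS UnB => s /= nVB.
  by have [|//] := in_ultra_setVsetC [set r | B (s * r)%g] bV.
split.
  split.
    rewrite /ultra_mul/= => UV0; apply: U0.
    by apply: filterS UV0 => s; exact: V0.
  split.
  - by apply: (@filterS _ U _ setT) filterT => s _; exact: filterT.
  - move=> A B; rewrite /ultra_mul/= => UA UB.
    by apply: filterS (filterI UA UB) => s [VA VB]; exact: filterI VA VB.
  - move=> A B AB; rewrite /ultra_mul/=; apply: filterS => s.
    by apply: filterS => r; exact: AB.
(* Maximality: a proper filter extending the product cannot gain a set whose complement the product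
   already contains. *)
move=> G [G0 fG] sub; apply/seteqP; split=> // B GB.
have [//|/sub GnB] := mem_setVsetC B.
by exfalso; apply: G0; rewrite -(setICr B); exact: filterI.
Qed.

Lemma ultra_le_mull (U V : set_system S) :
  beta V -> ultra_le (trans_family S) U (ultra_mul U V).
Proof.
move=> [pV _] B UB; exists [set s | V [set r | B (s * r)%g]] => // H.
move=> /finite_fsetP[X ->] XV.
(* A finite intersection of members of [V] is in [V], hence nonempty; any point of it translates all
   of [X] at once. *)
have /filter_ex[r Xr] : V (\bigcap_(s in [set` X]) [set r | B (s * r)%g]).
  by apply: filter_bigI => s /XV.
exists (fun s => (s * r)%g); first by exists r.
by move=> _ [s Xs <-]; exact: Xr.
Qed.

Lemma ultra_le_mulr (U V : set_system S) :
  commutative (fun x y : S => (x * y)%g) ->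
  beta U -> ultra_le (trans_family S) V (ultra_mul U V).
Proof.
move=> mulC [pU _] B; rewrite /ultra_mul/= => /filter_ex[s VsB].
exists [set r | B (s * r)%g] => // H _ HB.
(* The section of [B] concerns left translation by [s]; commutativity turns it into a member of the
   family. *)
exists (fun r => (r * s)%g); first by exists s.
by move=> _ [r /HB/= Br <-]; rewrite [(r * s)%g]mulC.
Qed.

End UltraProduct.

Theorem corollary3p12 (S : monoidType)
  (mulC : commutative (fun x y : S => (x * y)%g)) :
  (forall U V : set_system S, beta U -> beta V ->
     exists W : set_system S,
       [/\ beta W, ultra_le (trans_family S) U W
         & ultra_le (trans_family S) V W])
  /\ maxset_beta (trans_family S) !=set0.
Proof.
have dir (U V : set_system S) : beta U -> beta V -> exists W,
    [/\ beta W, ultra_le (trans_family S) U W & ultra_le (trans_family S) V W].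
  move=> bU bV; exists (ultra_mul S U V).
  by split; [exact: ultra_mul_beta|exact: ultra_le_mull|exact: ultra_le_mulr].
split=> //; apply: (directed_maxset_beta_nonempty _ _ _ _ 1%g dir).
- by exists 1%g; apply/funext => s; rewrite mulg1.
(* Translating by [r] and then by [q] is translating by [r * q], in this order. *)
- move=> _ _ [r ->] [q ->]; exists (r * q)%g.
  by apply/funext => s /=; rewrite mulgA.
Qed.
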